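(* Let $G$ be a topological group, and let $\phi,\psi$ be two automorphisms of $G$ such that $\psi\in\mathrm{Inn}(G)\phi$. Then $G$ has the $\phi$-twisted Rokhlin property if and only if it has the $\psi$-twisted Rokhlin property. In particular, if $\psi\in\mathrm{Inn}(G)$, then $G$ has the $\psi$-twisted Rokhlin property if and only if it has the Rokhlin property.
   Context: Automorphisms are automorphisms of the underlying abstract group (not assumed continuous), and $\mathrm{Inn}(G)$ is the group of inner automorphisms. For $\phi\in\mathrm{Aut}(G)$, the $\phi$-twisted conjugacy class of $x\in G$ is $C_\phi(x)=\{gx\phi(g)^{-1} : g\in G\}$. $G$ has the $\phi$-twisted Rokhlin property if some $\phi$-twisted conjugacy class is dense in $G$. $G$ has the Rokhlin property if it contains a dense (ordinary) conjugacy class. *)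

(* Defs.v *)
From HB Require Import structures.
From mathcomp Require Import all_boot.
From mathcomp Require Import all_classical topology.

Set Implicit Arguments.
Unset Strict Implicit.
Unset Printing Implicit Defensive.

Local Open Scope classical_set_scope.
Local Open Scope group_scope.

HB.structure Definition PreTopologicalGroup := {G of Topological G & Group G}.

(* No separation axiom is assumed. *)
HB.mixin Record PreTopologicalGroup_isTopologicalGroup G
    & PreTopologicalGroup G := {
  mulg_continuous : continuous (fun x : G * G => x.1 * x.2) ;
  invg_continuous : continuous (fun x : G => x^-1)
}.

#[short(type="topologicalGroupType")]
HB.structure Definition TopologicalGroup :=
  {G of PreTopologicalGroup G & PreTopologicalGroup_isTopologicalGroup G}.

(* Automorphisms of the abstract group; continuity is not required. *)
Definition Aut (G : groupType) : set (G -> G) :=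
  [set f | {morph f : x y / x * y} /\ bijective f].
Arguments Aut G : clear implicits.

(* [x ^ g] is [g^-1 * x * g]; as [g] ranges over [G], these are also the maps
   [x |-> g * x * g^-1]. *)
Definition Inn (G : groupType) : set (G -> G) :=
  [set (fun x => x ^ g) | g in [set: G]].
Arguments Inn G : clear implicits.

(* The coset Inn(G)phi. *)
Definition Inn_coset (G : groupType) (phi : G -> G) : set (G -> G) :=
  [set iota \o phi | iota in Inn G].

Definition conj_class (G : groupType) (x : G) : set G :=
  [set x ^ g | g in [set: G]].

Definition twisted_conj_class (G : groupType) (phi : G -> G) (x : G) : set G :=
  [set g * x * (phi g)^-1 | g in [set: G]].

Definition rokhlin (G : topologicalGroupType) : Prop :=
  exists x : G, dense (conj_class x).

Definition twisted_rokhlin (G : topologicalGroupType) (phi : G -> G) : Prop :=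
  exists x : G, dense (twisted_conj_class phi x).

(* Main.v *)
Require Import Defs.
From HB Require Import structures.
From mathcomp Require Import all_boot.
From mathcomp Require Import all_classical topology.

(** Write [psi g = h^-1 * phi g * h].  Then
    [g * (x * h) * (psi g)^-1 = (g * x * (phi g)^-1) * h], so the
    [psi]-twisted class of [x * h] is the right translate by [h] of the
    [phi]-twisted class of [x] ([twisted_conj_class_conjg]).  Right translations
    are homeomorphisms, hence preserve density ([dense_mulgr]), and a dense
    twisted class for [phi] gives one for [psi].  The situation is symmetric,
    since [phi] is obtained from [psi] by conjugating back with [h^-1].
    The second equivalence is the case [phi = id], whose twisted classes are
    the ordinary conjugacy classes ([twisted_conj_class_id]). *)

Local Open Scope classical_set_scope.
Local Open Scope group_scope.

Lemma mulgr_continuous (G : topologicalGroupType) (h : G) :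
  continuous (fun x : G => x * h).
Proof.
move=> x; apply: (@continuous2_cvg _ _ _ _ _ _ id (fun=> h) (fun x y => x * y)).
- exact: (@mulg_continuous G (x, h)).
- exact: cvg_id.
- exact: cvg_cst.
Qed.

(** A nonempty open set [O] meets [S * h] because its preimage under
    translation by [h] is again open and nonempty, hence meets [S]. *)
Lemma dense_mulgr (G : topologicalGroupType) (h : G) (S : set G) :
  dense S -> dense [set x * h | x in S].
Proof.
move=> dS O [y Oy] oO.
have [|x [Oxh Sx]] := dS ((fun x => x * h) @^-1` O) _
  (open_comp (fun x _ => mulgr_continuous G h x) oO).
  by exists (y * h^-1); rewrite /preimage /= mulgVK.
by exists (x * h); split=> //; exists x.
Qed.

Lemma twisted_conj_class_conjg (G : groupType) (phi : G -> G) (h x : G) :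
  twisted_conj_class (fun g => phi g ^ h) (x * h) =
  [set y * h | y in twisted_conj_class phi x].
Proof.
rewrite /twisted_conj_class image_comp; apply: eq_imagel => g _ /=.
by rewrite conjgE !invgM invgK !mulgA mulgK.
Qed.

Lemma twisted_rokhlin_conjg (G : topologicalGroupType) (phi : G -> G) (h : G) :
  twisted_rokhlin phi <-> twisted_rokhlin (fun g => phi g ^ h).
Proof.
have imp f k : twisted_rokhlin f -> twisted_rokhlin (fun g : G => f g ^ k).
  move=> [x dx]; exists (x * k).
  by rewrite twisted_conj_class_conjg; exact: dense_mulgr.
split=> [|/(imp _ h^-1)]; first exact: imp.
by under [X in twisted_rokhlin X]eq_fun do rewrite conjgK.
Qed.

(** The two sides are parametrised by mutually inverse elements:
    [g * x * g^-1 = x ^ g^-1]. *)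
Lemma twisted_conj_class_id (G : groupType) (x : G) :
  twisted_conj_class id x = conj_class x.
Proof.
apply/seteqP; split=> _ [g _ <-]; exists g^-1 => //.
  by rewrite conjgE invgK mulgA.
by rewrite conjgE invgK mulgA.
Qed.

Lemma twisted_rokhlin_id (G : topologicalGroupType) :
  twisted_rokhlin (@id G) <-> rokhlin G.
Proof.
by split=> -[x dx]; exists x; move: dx; rewrite twisted_conj_class_id.
Qed.

Theorem proposition3p5 (G : topologicalGroupType) (phi psi : G -> G)
    (phi_aut : Aut G phi) (psi_aut : Aut G psi) :
  (Inn_coset phi psi -> (twisted_rokhlin phi <-> twisted_rokhlin psi)) /\
  (Inn G psi -> (twisted_rokhlin psi <-> rokhlin G)).
Proof.
split.
  by move=> [_ [h _ <-] <-]; exact: twisted_rokhlin_conjg.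
move=> [h _ <-]; apply: iff_trans (twisted_rokhlin_id G).
exact: iff_sym (twisted_rokhlin_conjg G id h).
Qed.
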